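(* The following rules are derivable in $\mathbf{GAMALL}$, for all formulae $A,B$: $(R\Diamond R\boxdot)$ from $A\Rightarrow B$ infer ${}\Rightarrow\Diamond(A\to\boxdot B)$; $(R\Diamond L\Diamond)$ from $A\Rightarrow B$ infer ${}\Rightarrow\Diamond(\Diamond A\to B)$.
   Context: Formulae are built from propositional variables and constants $0,1,\bot,\top$ using the connectives $\otimes$, $\oplus$ (multiplicative disjunction, ''par''), $\land$, $\lor$ (additive conjunction and disjunction), $\neg$, $\to$. A sequent $\Gamma\Rightarrow\Delta$ is a pair of finite multisets of formulae; commas denote multiset union. A rule is derivable in a calculus if its conclusion can be derived from its premisses using the rules of the calculus. The calculus $\mathbf{GMALL}$ for Multiplicative Additive Linear Logic has the following rules (no cut, weakening or contraction). Axioms: $A\Rightarrow A$; $0\Rightarrow{}$; ${}\Rightarrow 1$; $\bot,\Gamma\Rightarrow\Delta$; $\Gamma\Rightarrow\Delta,\top$. $(R0)$ from $\Gamma\Rightarrow\Delta$ infer $\Gamma\Rightarrow\Delta,0$. $(L1)$ from $\Gamma\Rightarrow\Delta$ infer $1,\Gamma\Rightarrow\Delta$. $(L\otimes)$ from $\Gamma,A,B\Rightarrow\Delta$ infer $A\otimes B,\Gamma\Rightarrow\Delta$. $(R\otimes)$ from $\Gamma\Rightarrow\Delta,A$ and $\Gamma'\Rightarrow\Delta',B$ infer $\Gamma,\Gamma'\Rightarrow\Delta,\Delta',A\otimes B$. $(L\oplus)$ from $A,\Gamma\Rightarrow\Delta$ and $B,\Gamma'\Rightarrow\Delta'$ infer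 $A\oplus B,\Gamma,\Gamma'\Rightarrow\Delta,\Delta'$. $(R\oplus)$ from $\Gamma\Rightarrow\Delta,A,B$ infer $\Gamma\Rightarrow\Delta,A\oplus B$. $(L\land_1),(L\land_2)$ from $A,\Gamma\Rightarrow\Delta$, respectively from $B,\Gamma\Rightarrow\Delta$, infer $A\land B,\Gamma\Rightarrow\Delta$. $(R\land)$ from $\Gamma\Rightarrow\Delta,A$ and $\Gamma\Rightarrow\Delta,B$ infer $\Gamma\Rightarrow\Delta,A\land B$. $(L\lor)$ from $A,\Gamma\Rightarrow\Delta$ and $B,\Gamma\Rightarrow\Delta$ infer $A\lor B,\Gamma\Rightarrow\Delta$. $(R\lor_1),(R\lor_2)$ from $\Gamma\Rightarrow\Delta,A$, respectively from $\Gamma\Rightarrow\Delta,B$, infer $\Gamma\Rightarrow\Delta,A\lor B$. $(L\neg)$ from $\Gamma\Rightarrow\Delta,A$ infer $\neg A,\Gamma\Rightarrow\Delta$. $(R\neg)$ from $A,\Gamma\Rightarrow\Delta$ infer $\Gamma\Rightarrow\Delta,\neg A$. $(L\to)$ from $\Gamma\Rightarrow\Delta,A$ and $B,\Gamma'\Rightarrow\Delta'$ infer $A\to B,\Gamma,\Gamma'\Rightarrow\Delta,\Delta'$. $(R\to)$ from $A,\Gamma\Rightarrow\Delta,B$ infer $\Gamma\Rightarrow\Delta,A\to B$. $\mathbf{GAMALL}$ (a calculus for Affine Logic) is $\mathbf{GMALL}$ extended with the weakening rules $(LW)$: from $\Gamma\Rightarrow\Delta$ infer $A,\Gamma\Rightarrow\Delta$;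 $(RW)$: from $\Gamma\Rightarrow\Delta$ infer $\Gamma\Rightarrow\Delta,A$. The Tarskian modalities are the abbreviations $\Diamond A := \neg A\to A$ and $\boxdot A := \neg\Diamond\neg A$. *)

(* Defs.v *)
From HB Require Import structures.
From mathcomp Require Import all_boot.
From mathcomp Require Import finmap multiset.

Set Implicit Arguments.
Unset Strict Implicit.
Unset Printing Implicit Defensive.

Local Open Scope mset_scope.

(* [Zero]/[One] are the multiplicative constants 0, 1 (units of [Par] and
   [Tensor]); [Bot]/[Top] are the additive ones (units of [Or] and [And]). *)
Inductive form : Type :=
  | Var of nat
  | Zero | One | Bot | Top
  | Tensor of form & form
  | Par of form & form
  | And of form & form
  | Or of form & form
  | Neg of form
  | Imp of form & form.

(* Encoding into generic trees, used only to make [form] a [choiceType], as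
   required by [{mset form}]. *)
Fixpoint form_encode (A : form) : GenTree.tree nat :=
  match A with
  | Var n => GenTree.Leaf n
  | Zero => GenTree.Node 0 [::]
  | One => GenTree.Node 1 [::]
  | Bot => GenTree.Node 2 [::]
  | Top => GenTree.Node 3 [::]
  | Tensor B C => GenTree.Node 4 [:: form_encode B; form_encode C]
  | Par B C => GenTree.Node 5 [:: form_encode B; form_encode C]
  | And B C => GenTree.Node 6 [:: form_encode B; form_encode C]
  | Or B C => GenTree.Node 7 [:: form_encode B; form_encode C]
  | Neg B => GenTree.Node 8 [:: form_encode B]
  | Imp B C => GenTree.Node 9 [:: form_encode B; form_encode C]
  end.

Fixpoint form_decode (t : GenTree.tree nat) : option form :=
  match t with
  | GenTree.Leaf n => Some (Var n)
  | GenTree.Node 0 [::] => Some Zero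
  | GenTree.Node 1 [::] => Some One
  | GenTree.Node 2 [::] => Some Bot
  | GenTree.Node 3 [::] => Some Top
  | GenTree.Node k [:: t1; t2] =>
      match form_decode t1, form_decode t2 with
      | Some B, Some C =>
          match k with
          | 4 => Some (Tensor B C)
          | 5 => Some (Par B C)
          | 6 => Some (And B C)
          | 7 => Some (Or B C)
          | 9 => Some (Imp B C)
          | _ => None
          end
      | _, _ => None
      end
  | GenTree.Node 8 [:: t1] => omap Neg (form_decode t1)
  | _ => None
  end.

Lemma form_encodeK : pcancel form_encode form_decode.
Proof.
by elim=> //= [B IHB C IHC|B IHB C IHC|B IHB C IHC|B IHB C IHC|B IHB|B IHB C IHC];
  rewrite IHB ?IHC.
Qed.

HB.instance Definition _ := Countable.copy form (pcan_type form_encodeK).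

Definition Diamond (A : form) : form := Imp (Neg A) A.
Definition Boxdot (A : form) : form := Neg (Diamond (Neg A)).

Definition sequent : Type := ({mset form} * {mset form})%type.

Notation "G =>> D" := ((G%mset, D%mset) : sequent)
  (at level 70, no associativity).

(* A calculus is given by its rule instances: the list of premisses and the
   conclusion.  As sequents consist of multisets, no exchange rule is needed. *)
Definition calculus : Type := seq sequent -> sequent -> Prop.

Inductive GMALL : calculus :=
  | Ax A : GMALL [::] ([mset A] =>> [mset A])
  | L0 : GMALL [::] ([mset Zero] =>> mset0)
  | R1 : GMALL [::] (mset0 =>> [mset One])
  | LBot G D : GMALL [::] ([mset Bot] `+` G =>> D)
  | RTop G D : GMALL [::] (G =>> D `+` [mset Top])
  | R0 G D : GMALL [:: G =>> D] (G =>> D `+` [mset Zero])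
  | L1 G D : GMALL [:: G =>> D] ([mset One] `+` G =>> D)
  | LTensor G D A B :
      GMALL [:: G `+` [mset A] `+` [mset B] =>> D] ([mset Tensor A B] `+` G =>> D)
  | RTensor G G' D D' A B :
      GMALL [:: G =>> D `+` [mset A]; G' =>> D' `+` [mset B]]
            (G `+` G' =>> D `+` D' `+` [mset Tensor A B])
  | LPar G G' D D' A B :
      GMALL [:: [mset A] `+` G =>> D; [mset B] `+` G' =>> D']
            ([mset Par A B] `+` G `+` G' =>> D `+` D')
  | RPar G D A B :
      GMALL [:: G =>> D `+` [mset A] `+` [mset B]] (G =>> D `+` [mset Par A B])
  | LAnd1 G D A B :
      GMALL [:: [mset A] `+` G =>> D] ([mset And A B] `+` G =>> D)
  | LAnd2 G D A B :
      GMALL [:: [mset B] `+` G =>> D] ([mset And A B] `+` G =>> D)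
  | RAnd G D A B :
      GMALL [:: G =>> D `+` [mset A]; G =>> D `+` [mset B]]
            (G =>> D `+` [mset And A B])
  | LOr G D A B :
      GMALL [:: [mset A] `+` G =>> D; [mset B] `+` G =>> D]
            ([mset Or A B] `+` G =>> D)
  | ROr1 G D A B :
      GMALL [:: G =>> D `+` [mset A]] (G =>> D `+` [mset Or A B])
  | ROr2 G D A B :
      GMALL [:: G =>> D `+` [mset B]] (G =>> D `+` [mset Or A B])
  | LNeg G D A :
      GMALL [:: G =>> D `+` [mset A]] ([mset Neg A] `+` G =>> D)
  | RNeg G D A :
      GMALL [:: [mset A] `+` G =>> D] (G =>> D `+` [mset Neg A])
  | LImp G G' D D' A B :
      GMALL [:: G =>> D `+` [mset A]; [mset B] `+` G' =>> D']
            ([mset Imp A B] `+` G `+` G' =>> D `+` D')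
  | RImp G D A B :
      GMALL [:: [mset A] `+` G =>> D `+` [mset B]] (G =>> D `+` [mset Imp A B]).

Inductive GAMALL : calculus :=
  | GAMALL_GMALL ps c : GMALL ps c -> GAMALL ps c
  | LW G D A : GAMALL [:: G =>> D] ([mset A] `+` G =>> D)
  | RW G D A : GAMALL [:: G =>> D] (G =>> D `+` [mset A]).

(* [derivable R hyps s]: the rule with premisses [hyps] and conclusion [s] is
   derivable in [R], i.e. there is an [R]-derivation of [s] whose leaves are
   axioms of [R] or members of [hyps]; the latter may be used any number of
   times, including zero. *)
Inductive derivable (R : calculus) (hyps : seq sequent) : sequent -> Prop :=
  | derivable_hyp s : s \in hyps -> derivable R hyps s
  | derivable_rule ps s :
      R ps s -> (forall p, p \in ps -> derivable R hyps p) ->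
      derivable R hyps s.

(* Main.v *)
Require Import Defs.
From mathcomp Require Import all_boot.
From mathcomp Require Import finmap multiset.

Local Open Scope mset_scope.

(** In affine logic [Diamond C], that is [Neg C -> C], follows from the sequent
    with two copies of [C] on the right, so the diamond of an implication
    allows both its antecedent and its succedent to be used twice
    ([Diamond_Imp_intro]).  The premiss [A => B] may also be used twice, and
    the implication hidden in each modality merges the two uses by its left
    rule.
    - Used as [A => Neg (Neg B)] and as [Neg B, A => ], it gives
      [Diamond (Neg B), A, A => ], hence [A, A => Boxdot B]
      ([Boxdot_right]).  The second copy of [Boxdot B] comes from weakening.
    - Used as [ => B, Neg A] and as it stands, it gives [Diamond A => B, B]
      ([Diamond_left]).  The second copy of [Diamond A] comes from weakening. *)

Lemma derivable_rule1 (R : calculus) hyps p s :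
  R [:: p] s -> derivable R hyps p -> derivable R hyps s.
Proof.
by move=> rs dp; apply: derivable_rule rs _ => q; rewrite inE => /eqP->.
Qed.

Lemma derivable_rule2 (R : calculus) hyps p q s :
  R [:: p; q] s -> derivable R hyps p -> derivable R hyps q ->
  derivable R hyps s.
Proof.
move=> rs dp dq; apply: derivable_rule rs _ => r.
by rewrite !inE => /orP[] /eqP->.
Qed.

(** One copy of [C] is moved to the left as [Neg C], the other becomes the
    succedent of [Imp (Neg C) C]. *)
Lemma Diamond_intro hyps C :
  derivable GAMALL hyps (mset0 =>> [mset C] `+` [mset C]) ->
  derivable GAMALL hyps (mset0 =>> [mset Diamond C]).
Proof.
move=> dCC; rewrite -[[mset Diamond C]]mset0D.
apply: derivable_rule1; first exact/GAMALL_GMALL/RImp.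
rewrite mset0D.
by apply: derivable_rule1 dCC; exact/GAMALL_GMALL/LNeg.
Qed.

(** Both copies of [Imp C E] are introduced on the right, and each of them
    consumes one [C] and one [E]. *)
Lemma Diamond_Imp_intro hyps C E :
  derivable GAMALL hyps ([mset C] `+` [mset C] =>> [mset E] `+` [mset E]) ->
  derivable GAMALL hyps (mset0 =>> [mset Diamond (Imp C E)]).
Proof.
move=> dCE; apply: Diamond_intro.
apply: derivable_rule1; first exact/GAMALL_GMALL/RImp.
(* The right rule acts on the last formula: the other [Imp C E] goes there. *)
rewrite msetD0 [X in _ =>> X]msetDC.
by apply: derivable_rule1 dCE; exact/GAMALL_GMALL/RImp.
Qed.

(** The two copies of [A] pay for the two premisses of the left rule for
    [Diamond (Neg B) = Imp (Neg (Neg B)) (Neg B)]; each reduces to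
    [Neg B, A => ]. *)
Lemma Boxdot_right hyps A B :
  derivable GAMALL hyps ([mset A] =>> [mset B]) ->
  derivable GAMALL hyps ([mset A] `+` [mset A] =>> [mset Boxdot B]).
Proof.
move=> dAB; rewrite -[[mset Boxdot B]]mset0D.
have dNBA : derivable GAMALL hyps ([mset Neg B] `+` [mset A] =>> mset0).
  apply: derivable_rule1; first exact/GAMALL_GMALL/LNeg.
  by rewrite mset0D.
apply: derivable_rule1; first exact/GAMALL_GMALL/RNeg.
rewrite msetDA -[X in _ =>> X]msetD0.
apply: derivable_rule2; first exact/GAMALL_GMALL/LImp.
- by apply: derivable_rule1 dNBA; exact/GAMALL_GMALL/RNeg.
- exact: dNBA.
Qed.

(** Both premisses of the left rule for [Imp (Neg A) A] come from [A => B],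
    and their contexts add up to two copies of [B]. *)
Lemma Diamond_left hyps A B :
  derivable GAMALL hyps ([mset A] =>> [mset B]) ->
  derivable GAMALL hyps ([mset Diamond A] =>> [mset B] `+` [mset B]).
Proof.
move=> dAB; rewrite -[[mset Diamond A]]msetD0 -[[mset Diamond A] `+` _]msetD0.
apply: derivable_rule2; first exact/GAMALL_GMALL/LImp.
- apply: derivable_rule1; first exact/GAMALL_GMALL/RNeg.
  by rewrite msetD0.
- by rewrite msetD0.
Qed.

Theorem mainTheorem10 (A B : form) :
  derivable GAMALL [:: [mset A] =>> [mset B]]
    (mset0 =>> [mset Diamond (Imp A (Boxdot B))]) /\
  derivable GAMALL [:: [mset A] =>> [mset B]]
    (mset0 =>> [mset Diamond (Imp (Diamond A) B)]).
Proof.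
have dAB : derivable GAMALL [:: [mset A] =>> [mset B]] ([mset A] =>> [mset B]).
  by apply: derivable_hyp; rewrite inE.
split; apply: Diamond_Imp_intro.
- by apply: derivable_rule1 (Boxdot_right _ _ _ dAB); exact: RW.
- by apply: derivable_rule1 (Diamond_left _ _ _ dAB); exact: LW.
Qed.
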